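(* Let $P$ and $Q$ be face posets of $d$-dimensional convex polytopes, with maximum elements $\hat 1^P,\hat 1^Q$, and let $R$ be the face poset of a $(d-1)$-dimensional convex polytope, with maximum element $\hat 1^R$. Suppose $F_P\in P$ and $F_Q\in Q$ are elements of rank $d-1$ and $\phi^P:R\to[\emptyset,F_P]$, $\phi^Q:R\to[\emptyset,F_Q]$ are rank-preserving poset isomorphisms. Define the poset $Gl=Gl(P,Q,R)$ with underlying set the disjoint union $$\bigl(P\setminus([\emptyset,F_P]\cup\{\hat 1^P\})\bigr)\ \sqcup\ \bigl(Q\setminus([\emptyset,F_Q]\cup\{\hat 1^Q\})\bigr)\ \sqcup\ \bigl(R\setminus\{\hat 1^R\}\bigr)\ \sqcup\ \{\hat 1\},$$ ranks inherited from $P,Q,R$ and $|\hat 1|=d$, and order: $\hat 1$ is above every element; two elements of the $P$-part (resp. $Q$-part, $R$-part) compare as in $P$ (resp. $Q$, $R$); for $a$ in the $P$-part and $r$ in the $R$-part, $a\le r$ iff $a\le_P\phi^P(r)$ and $r\le a$ iff $\phi^P(r)\le_P a$; likewise for the $Q$-part with $\phi^Q$; elements of the $P$-part and the $Q$-part are incomparable. Then $$\mathcal{M}_{Gl}(z)=\mathcal{M}_P(z)+\mathcal{M}_Q(z)-\mathcal{M}_R(z)-1+z-(1-z)\,g^R_{d-1}(z).$$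
   Context: The face poset of a convex polytope with vertex set $V$ is the set of vertex sets of its faces (including the whole polytope) together with $\emptyset$, ordered by inclusion, ranked by dimension ($|\emptyset|=-1$). $[a,b]=\{s:a\le s\le b\}$. (Geometrically, $Gl$ is the face poset of the polytope obtained by gluing the two polytopes along a common facet isomorphic to the polytope of $R$ and deleting that interior facet, assuming no faces merge.) The Möbius function $\mu$ is $\mu[p,p]=1$, $\mu[p,q]=-\sum_{p\le s<q}\mu[p,s]$ for $p<q$, $0$ if $p\not\le q$; $\mu_z[p,q]=\mu[p,q]z^{|q|-|p|}$; $\mathcal{M}_P(z)=\sum_{p\le q\in P}\mu_z[p,q]$; the top polynomial of $R$ (rank $d-1$) is $g^R_{d-1}(z)=\sum_{p\le q,\ |p|\le d-1\le|q|}\mu_z[p,q]$. *)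

(* Defs.v *)
From HB Require Import structures.
From mathcomp Require Import all_boot all_order all_algebra.
From Stdlib Require Import ClassicalEpsilon.
Set Implicit Arguments. Unset Strict Implicit. Unset Printing Implicit Defensive.
Import Order.TTheory GRing.Theory Num.Theory.
Local Open Scope ring_scope.

Definition pbool (P : Prop) : bool :=
  if excluded_middle_informative P then true else false.

Section Mobius.
Variables (T : finType) (A : {set T}) (le : rel T) (rk : T -> int).

(* mu[p,p] = 1, mu[p,q] = - sum_{p <= s < q} mu[p,s] for p < q, 0 if p not<= q.
   The fuel #|T| exceeds the length of every strict chain in A. *)
Fixpoint mob_rec (n : nat) (p q : T) : int :=
  match n with
  | 0 => if p == q then 1 else 0
  | n'.+1 =>
      if p == q then 1
      else if le p q then
        - \sum_(s in A | le p s && le s q && (s != q)) mob_rec n' p s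
      else 0
  end.

Definition mob (p q : T) : int := mob_rec #|T| p q.

Definition mobz (p q : T) : {poly int} :=
  (mob p q)%:P * 'X^(absz (rk q - rk p)).

Definition Mpoly : {poly int} :=
  \sum_(p in A) \sum_(q in A | le p q) mobz p q.

Definition gpoly (m : int) : {poly int} :=
  \sum_(p in A) \sum_(q in A | le p q && (rk p <= m) && (m <= rk q)) mobz p q.

End Mobius.

(* Convex polytopes given by a finite point family V : 'I_k -> R^n     *)
(* (the vertices), and their face posets (faces = vertex sets).        *)
Section Polytope.
Variables (R : realFieldType) (n k : nat) (V : 'I_k -> 'rV[R]_n).

Definition dotp (c x : 'rV[R]_n) : R := \sum_(j < n) c 0 j * x 0 j.

(* S is the vertex set of a face of conv(V): cut out by a valid inequality *)
Definition is_face (S : {set 'I_k}) : Prop :=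
  exists (c : 'rV[R]_n) (b : R),
    (forall i, dotp c (V i) <= b) /\ (forall i, (i \in S) = (dotp c (V i) == b)).

Definition is_vertex_family : Prop := forall i, is_face [set i].

Definition faceset : {set {set 'I_k}} := [set S | pbool (is_face S)].

Definition affdim (S : {set 'I_k}) : int :=
  if [pick i in S] is Some i0 then
    (\rank (\matrix_(i < k) (if i \in S then V i - V i0 else 0)))%:Z
  else -1.

Definition fle : rel {set 'I_k} := fun S S' => S \subset S'.

Definition polytope_of_dim (d : int) : Prop :=
  is_vertex_family /\ affdim setT = d.

End Polytope.

Definition face_iso (K : realFieldType) (nR kR nP kP : nat)
  (VR : 'I_kR -> 'rV[K]_nR) (VP : 'I_kP -> 'rV[K]_nP)
  (F : {set 'I_kP}) (phi : {set 'I_kR} -> {set 'I_kP}) : Prop :=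
  [/\ (forall r, r \in faceset VR -> phi r \in faceset VP /\ phi r \subset F),
      (forall S, S \in faceset VP -> S \subset F ->
                 exists2 r, r \in faceset VR & phi r = S),
      (forall r1 r2, r1 \in faceset VR -> r2 \in faceset VR ->
                 (phi r1 \subset phi r2) = (r1 \subset r2)) &
      (forall r, r \in faceset VR -> affdim VP (phi r) = affdim VR r)].

(* The glued poset Gl(P,Q,R).  Carrier type:                           *)
(*   inl a             : element a of the P-part                       *)
(*   inr (inl b)       : element b of the Q-part                       *)
(*   inr (inr (Some r)): element r of the R-part                       *)
(*   inr (inr None)    : the new top element 1^                        *)
Section Glue.
Variables (K : realFieldType) (nP kP nQ kQ nR kR : nat) (d : nat).
Variables (VP : 'I_kP -> 'rV[K]_nP) (VQ : 'I_kQ -> 'rV[K]_nQ)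
          (VR : 'I_kR -> 'rV[K]_nR).
Variables (FP : {set 'I_kP}) (FQ : {set 'I_kQ}).
Variables (phiP : {set 'I_kR} -> {set 'I_kP}) (phiQ : {set 'I_kR} -> {set 'I_kQ}).

Definition glT : finType :=
  ({set 'I_kP} + ({set 'I_kQ} + option {set 'I_kR}))%type.

Definition glA : {set glT} :=
  [set x : glT |
    match x with
    | inl a => [&& a \in faceset VP, ~~ (a \subset FP) & a != setT]
    | inr (inl b) => [&& b \in faceset VQ, ~~ (b \subset FQ) & b != setT]
    | inr (inr (Some r)) => (r \in faceset VR) && (r != setT)
    | inr (inr None) => true
    end].

Definition glle : rel glT := fun x y =>
  match x, y with
  | _, inr (inr None) => true
  | inr (inr None), _ => false
  | inl a, inl a' => a \subset a'
  | inr (inl b), inr (inl b') => b \subset b'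
  | inr (inr (Some r)), inr (inr (Some r')) => r \subset r'
  | inl a, inr (inr (Some r)) => a \subset phiP r
  | inr (inr (Some r)), inl a => phiP r \subset a
  | inr (inl b), inr (inr (Some r)) => b \subset phiQ r
  | inr (inr (Some r)), inr (inl b) => phiQ r \subset b
  | inl _, inr (inl _) => false
  | inr (inl _), inl _ => false
  end.

Definition glrk (x : glT) : int :=
  match x with
  | inl a => affdim VP a
  | inr (inl b) => affdim VQ b
  | inr (inr (Some r)) => affdim VR r
  | inr (inr None) => d%:Z
  end.

End Glue.

(* Main.v *)
(* Write M = sum_q C(q) with C(q) = sum_p mu_z[p,q].  C(q) only depends on the down-set
   of q, and the down-sets of Gl strictly below the top are down-sets of P, of Q or of R;
   hence M_Gl - C_Gl(top) = (M_P - C_P(1) - M_R) + (M_Q - C_Q(1) - M_R) + (M_R - C_R(1)).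
   Since the values mu[p, .] sum to 0 in each poset, mu_Gl[p, top] is mu_P[p, 1] on the
   P-part and mu_Q[p, 1] on the Q-part, while on the proper faces of R it is
   mu_P[phi^P p, 1] + mu_Q[phi^Q p, 1] + mu_R[p, 1].  With mu_P[F_P, 1] = mu_Q[F_Q, 1] = -1
   this gives C_Gl(top) = C_P(1) + C_Q(1) + z C_R(1) - 1 + z, and C_R(1) is the top
   polynomial of R.  The only geometric input is that the dimension is strictly
   increasing on faces. *)
Require Import Defs.
From HB Require Import structures.
From mathcomp Require Import all_boot all_order all_algebra.
From mathcomp Require Import ring.
Import Order.TTheory GRing.Theory Num.Theory.
Local Open Scope ring_scope.
Set Implicit Arguments. Unset Strict Implicit. Unset Printing Implicit Defensive.

(** * Membership in the face poset *)

Lemma facesetP (K : realFieldType) (n k : nat) (V : 'I_k -> 'rV[K]_n) (S : {set 'I_k}) :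
  reflect (is_face V S) (S \in faceset V).
Proof.
rewrite inE /pbool; case: (ClassicalEpsilon.excluded_middle_informative _) => h.
  by constructor.
by constructor.
Qed.

Lemma setT_face (K : realFieldType) (n k : nat) (V : 'I_k -> 'rV[K]_n) :
  setT \in faceset V.
Proof.
(* The inequality 0 <= 0 is valid and tight at every vertex. *)
apply/facesetP; exists 0, 0; have dot0 x : dotp (0 : 'rV[K]_n) x = 0.
  by apply: big1 => j _; rewrite mxE mul0r.
by split=> i; rewrite dot0 // inE eqxx.
Qed.

(** * Affine dimension and its strict growth along faces *)

Definition dirmx (K : realFieldType) (n k : nat) (V : 'I_k -> 'rV[K]_n)
    (S : {set 'I_k}) (i0 : 'I_k) : 'M[K]_(k, n) :=
  \matrix_(i < k) (if i \in S then V i - V i0 else 0).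

Section AffineDimension.
Variables (K : realFieldType) (n k : nat) (V : 'I_k -> 'rV[K]_n).
Implicit Types (S : {set 'I_k}) (i : 'I_k).

Lemma sub_dirmx S i i0 : i \in S -> (V i - V i0 <= dirmx V S i0)%MS.
Proof. by move=> iS; have := row_sub i (dirmx V S i0); rewrite rowK iS. Qed.

(** A direction based at [i0] is a difference of two directions based at [i1]. With [S = S'] this
    makes the rank independent of the base point. *)
Lemma dirmx_sub S S' i0 i1 : S \subset S' -> i0 \in S' ->
  (dirmx V S i0 <= dirmx V S' i1)%MS.
Proof.
move=> /subsetP sSS' i0S'; apply/row_subP => i; rewrite rowK.
case: ifP => [/sSS' iS'|_]; last exact: sub0mx.
have ->: V i - V i0 = (V i - V i1) - (V i0 - V i1).
  by rewrite opprB addrA subrK.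
by rewrite addmx_sub ?eqmx_opp ?sub_dirmx.
Qed.

Lemma affdimE S i0 : i0 \in S -> affdim V S = (\rank (dirmx V S i0))%:Z.
Proof.
move=> i0S; rewrite /affdim; case: pickP => [i1 i1S|/(_ i0)]; last by rewrite i0S.
by congr (Posz _); apply/eqP; rewrite eqn_leq !mxrankS ?dirmx_sub.
Qed.

Lemma affdim0 : affdim V set0 = -1.
Proof. by rewrite /affdim; case: pickP => // i; rewrite inE. Qed.

Lemma affdim_mono S S' : S \subset S' -> affdim V S <= affdim V S'.
Proof.
case: (set_0Vmem S) => [-> _|[i iS] sSS'].
  by rewrite affdim0 /affdim; case: pickP.
have iS' := subsetP sSS' i iS.
by rewrite !(affdimE (i0 := i)) // lez_nat mxrankS ?dirmx_sub.
Qed.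

Lemma dotpE (c x : 'rV[K]_n) : dotp c x = (x *m c^T) 0 0.
Proof. by rewrite mxE; apply: eq_bigr => j _; rewrite mxE mulrC. Qed.

(* A supporting functional of [S] vanishes on the directions of [S], but not on
   the direction towards a point outside [S]. *)
Lemma affdim_lt S S' : S \in faceset V -> S \proper S' ->
  affdim V S < affdim V S'.
Proof.
move=> /facesetP[c [b [_ SE]]] /properP[sSS' [j jS' jNS]].
case: (set_0Vmem S) => [->|[i iS]].
  by rewrite affdim0 (affdimE jS').
have iS' := subsetP sSS' i iS.
rewrite !(affdimE (i0 := i)) // ltz_nat rank_ltmx // ltmxE dirmx_sub //=.
apply/negP => sub; have /submxP[D Dj] := submx_trans (sub_dirmx i jS') sub.
have kills : dirmx V S i *m c^T = 0.
  apply/row_matrixP => l; rewrite row_mul rowK row0.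
  case: ifP => lS; last by rewrite mul0mx.
  apply/rowP => u; rewrite ord1 mulmxBl !mxE.
  move: lS iS; rewrite !SE !dotpE !mxE => /eqP-> /eqP->; exact: subrr.
move: jNS; rewrite SE dotpE -(subrK (V i) (V j)) mulmxDl Dj -mulmxA kills mulmx0.
by rewrite add0r -dotpE -SE iS.
Qed.

End AffineDimension.

(** * Möbius functions of finite posets: sufficient fuel, row sums and column sums *)

Section Mobius.
Variables (T : finType) (A : {set T}) (le : rel T).
Hypothesis refl_le : {in A, reflexive le}.
Hypothesis anti_le : {in A &, antisymmetric le}.
Hypothesis trans_le : {in A & &, transitive le}.

Let below q := [set s in A | le s q && (s != q)].

(** The number of elements strictly below [q] is the measure that bounds the depth of the
    recursion. *)
Lemma card_below s q : s \in A -> q \in A -> le s q -> s != q ->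
  (#|below s| < #|below q|)%N.
Proof.
move=> sA qA ls nsq; apply: proper_card; apply/properP; split.
  apply/subsetP => t; rewrite !inE => /and3P[tA lts nts]; rewrite tA.
  rewrite (trans_le sA tA qA lts ls) /=; apply: contra nts => /eqP tq.
  by rewrite tq in lts *; apply/eqP/anti_le; rewrite // lts ls.
by exists s; rewrite !inE sA ?ls ?nsq // eqxx andbF.
Qed.

(** A call at [q] recurses only to elements strictly below [q], so once the fuel reaches
    [#|below q|] any further fuel changes nothing. *)
Lemma mob_rec_stable n m p q : p \in A -> q \in A ->
  (#|below q| <= n)%N -> (n <= m)%N -> mob_rec A le m p q = mob_rec A le n p q.
Proof.
move=> pA; elim: n m q => [|n IHn] [|m] q qA //= qn nm; case: eqVneq => // npq.
  case: ifP => // lpq; move: qn; rewrite leqn0 cards_eq0 => /eqP/setP/(_ p).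
  by rewrite !inE pA lpq npq.
case: ifP => // _; congr (- _); apply: eq_bigr => s /and3P[sA /andP[_ lsq] nsq].
apply: IHn => //; rewrite -ltnS; exact: leq_trans (card_below sA qA lsq nsq) qn.
Qed.

Lemma mob_recE n p q : p \in A -> q \in A -> (#|T| <= n)%N ->
  mob_rec A le n p q = mob A le p q.
Proof. by move=> pA qA; apply: mob_rec_stable => //; apply: max_card. Qed.

Lemma mob_id p : mob A le p p = 1.
Proof. by rewrite /mob; case: #|T| => [|n] /=; rewrite eqxx. Qed.

Lemma mob_nle p q : p \in A -> ~~ le p q -> mob A le p q = 0.
Proof.
move=> pA nle; have npq : (p == q) = false.
  by apply: contraNF nle => /eqP <-; apply: refl_le.
by rewrite /mob; case: #|T| => [|n] /=; rewrite npq ?(negbTE nle).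
Qed.

(** For [p != q] this is the defining recursion at the maximum [q], with all terms on one side. *)
Lemma sum_mob_max p q : p \in A -> q \in A -> {in A, forall s, le s q} ->
  \sum_(s in A) mob A le p s = (p == q)%:R.
Proof.
move=> pA qA top; rewrite (bigD1 q) //=.
(* One extra unit of fuel, so that unfolding once leaves summands that are exactly [mob]. *)
rewrite -(mob_recE pA qA (leqnSn _)) /= top //; case: (eqVneq p q) => [eqpq|npq].
  subst q.
  rewrite big1 ?addr0 // => s /andP[sA nsp]; apply: mob_nle => //.
  apply: contra nsp => lps; apply/eqP; apply: anti_le => //.
  by rewrite top // lps.
rewrite [X in _ + X](bigID (le p)) /= [X in _ + (_ + X)]big1 ?addr0; last first.
  by move=> s /andP[_]; apply: mob_nle.
apply/eqP; rewrite addrC subr_eq0; apply/eqP; apply: eq_bigl => s.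
by case sA: (s \in A) => //=; rewrite top // andbT andbC.
Qed.

Lemma MpolyE (rk : T -> int) :
  Mpoly A le rk = \sum_(q in A) \sum_(p in A) mobz A le rk p q.
Proof.
rewrite exchange_big /=; apply: eq_bigr => p pA.
rewrite [RHS](bigID (le p)) /= [X in _ = _ + X]big1 ?addr0 // => q /andP[_ nle].
by rewrite /mobz mob_nle // mul0r.
Qed.

End Mobius.

(** * Transport of Möbius values along an embedding of a down-set with down-closed image *)

Section Embedding.
Variables (T T' : finType) (A : {set T}) (A' : {set T'}).
Variables (le : rel T) (le' : rel T') (D : {set T}) (f : T -> T').
Hypothesis refl_le : {in A, reflexive le}.
Hypothesis anti_le : {in A &, antisymmetric le}.
Hypothesis trans_le : {in A & &, transitive le}.
Hypothesis anti_le' : {in A' &, antisymmetric le'}.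
Hypothesis trans_le' : {in A' & &, transitive le'}.
Hypothesis sDA : D \subset A.
Hypothesis downD : {in D & A, forall x y, le y x -> y \in D}.
Hypothesis fA : {in D, forall x, f x \in A'}.
Hypothesis fmono : {in D &, forall x y, le' (f x) (f y) = le x y}.
Hypothesis fdown : {in D & A', forall x y, le' y (f x) -> exists2 y0, y0 \in D & f y0 = y}.

Lemma embedding_inj : {in D &, injective f}.
Proof.
move=> x y xD yD fxy; have [xA yA] := (subsetP sDA x xD, subsetP sDA y yD).
by apply: anti_le; rewrite // -!fmono // fxy fmono // refl_le.
Qed.

(** The value depends only on the interval from [p] to [q]. Since [D] and its image are both closed
    downwards, [f] maps this interval onto the one from [f p] to [f q]. *)
Lemma mob_embedding p q : p \in D -> q \in D ->
  mob A' le' (f p) (f q) = mob A le p q.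
Proof.
move=> pD qD; have sub x (xD : x \in D) := subsetP sDA x xD.
(* A fuel sufficient on both sides; the two recursions then agree step by step, by induction on the
   fuel. *)
pose n := maxn #|T| #|T'|.
rewrite -(mob_recE anti_le trans_le (n := n) (sub _ pD) (sub _ qD)) ?leq_maxl //.
rewrite -(mob_recE anti_le' trans_le' (n := n) (fA pD) (fA qD)) ?leq_maxr //.
elim: n q qD => [|n IHn] q qD /=; rewrite (inj_in_eq embedding_inj) //.
rewrite fmono //; case: ifP => // _; case: ifP => // _; congr (- _).
pose I := [set s in A | le p s && le s q && (s != q)].
have ID s : s \in I -> s \in D.
  by rewrite inE => /andP[sA /andP[/andP[_ lsq] _]]; apply: downD lsq.
have imI : [set s in A' | le' (f p) s && le' s (f q) && (s != f q)] = f @: I.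
  apply/setP => s'; apply/idP/imsetP => [|[s sI ->]].
    rewrite inE => /and3P[s'A /andP[lps lsq] nsq].
    have [s sD fs] := fdown qD s'A lsq; subst s'.
    exists s => //; rewrite !fmono // (inj_in_eq embedding_inj) // in lps lsq nsq.
    by rewrite inE sub // lps lsq.
  have sD := ID s sI; move: sI.
  by rewrite !inE !fmono // (inj_in_eq embedding_inj) // fA // => /andP[].
rewrite -big_set imI big_imset /=; last by move=> s t /ID sD /ID tD; apply: embedding_inj.
rewrite [in RHS]big_mkcondr /=.
by rewrite -big_mkcondr /= -[RHS]big_set; apply: eq_bigr => s /ID; apply: IHn.
Qed.

Hypothesis refl_le' : {in A', reflexive le'}.

(** The nonzero terms of a column come from elements below its index, and [f] carries those below
    [q] bijectively onto those below [f q]. *)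
Lemma sum_mobz_embedding (rk : T -> int) (rk' : T' -> int) q :
  {in D, forall x, rk' (f x) = rk x} -> q \in D ->
  \sum_(p in A') mobz A' le' rk' p (f q) = \sum_(p in A) mobz A le rk p q.
Proof.
move=> rkf qD; have sub x (xD : x \in D) := subsetP sDA x xD.
have restrict (U : finType) (B : {set U}) (r : rel U) (k : U -> int) y :
    {in B, reflexive r} ->
    \sum_(p in B) mobz B r k p y = \sum_(p in [set p in B | r p y]) mobz B r k p y.
  move=> refl_r; rewrite big_set [LHS](bigID (r^~ y)) /=.
  rewrite [X in _ + X]big1 ?addr0 // => p /andP[pB nle].
  by rewrite /mobz (mob_nle refl_r) // mul0r.
rewrite !restrict //; set I := [set p in A | le p q].
have ID s : s \in I -> s \in D by rewrite inE => /andP[sA lsq]; apply: downD lsq.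
have imI : [set p in A' | le' p (f q)] = f @: I.
  apply/setP => s'; apply/idP/imsetP => [|[s sI ->]].
    rewrite inE => /andP[s'A lsq]; have [s sD fs] := fdown qD s'A lsq; subst s'.
    by exists s => //; rewrite fmono // in lsq; rewrite inE sub.
  have sD := ID s sI; move: sI; rewrite !inE fmono // fA // => /andP[].
  by [].
rewrite imI big_imset /=; last by move=> s t /ID sD /ID tD; apply: embedding_inj.
by apply: eq_bigr => s /ID sD; rewrite /mobz mob_embedding // !rkf.
Qed.

End Embedding.

(** * Face posets, and a facet identified with R *)

Lemma fle_refl k (A : {set {set 'I_k}}) : {in A, reflexive (@fle k)}.
Proof. by move=> x _; apply: subxx. Qed.

Lemma fle_anti k (A : {set {set 'I_k}}) : {in A &, antisymmetric (@fle k)}.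
Proof. by move=> x y _ _ xy; apply/eqP; rewrite eqEsubset. Qed.

Lemma fle_trans k (A : {set {set 'I_k}}) : {in A & &, transitive (@fle k)}.
Proof. by move=> y x z _ _ _; apply: subset_trans. Qed.

#[local] Hint Resolve fle_refl fle_anti fle_trans : core.

Notation face_mob V := (mob (faceset V) (@fle _)).
Notation face_mobz V := (mobz (faceset V) (@fle _) (affdim V)).

(** One side of the gluing, isolated so that each fact about it serves both P and Q. *)
Definition facet_chart (K : realFieldType) (nR kR nP kP : nat) (d : int)
    (VR : 'I_kR -> 'rV[K]_nR) (VP : 'I_kP -> 'rV[K]_nP) (F : {set 'I_kP})
    (phi : {set 'I_kR} -> {set 'I_kP}) : Prop :=
  [/\ affdim VP setT = d, F \in faceset VP, affdim VP F = d - 1 & face_iso VR VP F phi].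

Section FacetChart.
Variables (K : realFieldType) (nR kR nP kP : nat) (d : int).
Variables (VR : 'I_kR -> 'rV[K]_nR) (VP : 'I_kP -> 'rV[K]_nP) (F : {set 'I_kP}).
Variable phi : {set 'I_kR} -> {set 'I_kP}.
Hypothesis chart : facet_chart d VR VP F phi.

Lemma chart_sub r : r \in faceset VR -> phi r \subset F.
Proof. by case: chart => _ _ _ [h _ _ _] /h []. Qed.

Lemma chart_face r : r \in faceset VR -> phi r \in faceset VP.
Proof. by case: chart => _ _ _ [h _ _ _] /h []. Qed.

Lemma chart_onto S : S \in faceset VP -> S \subset F ->
  exists2 r, r \in faceset VR & phi r = S.
Proof. by case: chart => _ _ _ [_ h _ _]; apply: h. Qed.

Lemma chart_mono : {in faceset VR &, forall r s, (phi r \subset phi s) = (r \subset s)}.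
Proof. by case: chart => _ _ _ [_ _ h _] r s rR sR; apply: h. Qed.

Lemma chart_rank : {in faceset VR, forall r, affdim VP (phi r) = affdim VR r}.
Proof. by case: chart => _ _ _ [_ _ _ h] r; apply: h. Qed.

Lemma chart_inj : {in faceset VR &, injective phi}.
Proof.
move=> r s rR sR e; apply/eqP.
by rewrite eqEsubset -!chart_mono // e subxx.
Qed.

(** The preimage of [F] lies below [setT], so [F] lies below [phi setT], which lies inside [F]. *)
Lemma chart_setT : phi setT = F.
Proof.
have [_ FP _ _] := chart; have [r rR rF] := chart_onto FP (subxx F).
apply/eqP.
by rewrite eqEsubset chart_sub ?setT_face //= -rF chart_mono ?setT_face ?subsetT.
Qed.

Lemma facet_neqT : F != setT.
Proof.
have [dT _ dF _] := chart; apply: contra_eqN dF => /eqP->; rewrite dT.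
by rewrite -subr_eq0 opprB addrC subrK.
Qed.

(** A face strictly between [F] and the whole polytope would have dimension strictly between d-1 and
    d. *)
Lemma facet_maximal S : S \in faceset VP -> F \subset S -> S != F -> S = setT.
Proof.
have [dT FP dF _] := chart => SP FS nSF; apply/eqP/negPn/negP => nST.
have := affdim_lt FP (S' := S); have := affdim_lt SP (S' := setT).
rewrite !properEneq subsetT nST FS eq_sym nSF dT dF => /(_ isT) Sd /(_ isT).
by rewrite ltrBlDr ltzD1 leNgt Sd.
Qed.

Lemma mob_chart r s : r \in faceset VR -> s \in faceset VR ->
  face_mob VP (phi r) (phi s) = face_mob VR r s.
Proof.
move=> rR sR; apply: (mob_embedding (D := faceset VR)) => //.
- by move=> x; apply: chart_face.
- exact: chart_mono.
- move=> x y xR yP yx; apply: chart_onto => //.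
  exact: subset_trans yx (chart_sub xR).
Qed.

Lemma sum_mobz_chart s : s \in faceset VR ->
  \sum_(a in faceset VP) face_mobz VP a (phi s)
  = \sum_(r in faceset VR) face_mobz VR r s.
Proof.
move=> sR; apply: (sum_mobz_embedding (D := faceset VR)) => //.
- by move=> x; apply: chart_face.
- exact: chart_mono.
- move=> x y xR yP yx; apply: chart_onto => //.
  exact: subset_trans yx (chart_sub xR).
- exact: chart_rank.
Qed.

(** The splitting mirrors that of the glued poset; the index [setT] of the last sum stands for [F]
    itself. *)
Lemma sum_faces (M : zmodType) (G : {set 'I_kP} -> M) :
  \sum_(a in faceset VP) G a
  = \sum_(a | [&& a \in faceset VP, ~~ (a \subset F) & a != setT]) G a
    + G setT + \sum_(r in faceset VR) G (phi r).
Proof.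
rewrite (bigID (fun a : {set 'I_kP} => a \subset F)) /= addrC; congr (_ + _).
  rewrite (bigD1 setT) /=; last first.
    by rewrite setT_face subTset facet_neqT.
  by rewrite addrC; congr (_ + _); apply: eq_bigl => a; rewrite andbA.
rewrite -(big_imset _ chart_inj) /=; apply: eq_bigl => a.
apply/andP/imsetP => [[aP aF]|[r rR ->]].
  by have [r rR <-] := chart_onto aP aF; exists r.
by rewrite chart_face ?chart_sub.
Qed.

Lemma sum_chart_faces (M : zmodType) (G : {set 'I_kR} -> M) :
  \sum_(r in faceset VR) G r
  = \sum_(r | (r \in faceset VR) && (r != setT)) G r + G setT.
Proof. by rewrite (bigD1 setT) ?setT_face //= addrC. Qed.

(** Only [F] and the whole polytope lie above [F], so the row of [F] has two nonzero entries, and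
    they sum to 0. *)
Lemma mob_facet : face_mob VP F setT = -1.
Proof.
have [_ FP _ _] := chart.
have : \sum_(S in faceset VP) face_mob VP F S = 0.
  rewrite (sum_mob_max (@fle_refl _ _) (@fle_anti _ _) (@fle_trans _ _) FP (setT_face VP)).
    by rewrite (negbTE facet_neqT).
  by move=> S _; rewrite /fle subsetT.
rewrite (bigD1 F) //= mob_id (bigD1 setT) /=; last by rewrite setT_face eq_sym facet_neqT.
rewrite big1 ?addr0; first by move/eqP; rewrite addrC addr_eq0 => /eqP.
move=> S /andP[/andP[SP nSF] nST]; apply: mob_nle => //.
by apply: contra nST => FS; apply/eqP; apply: facet_maximal.
Qed.

Lemma mobz_facet : face_mobz VP F setT = - 'X.
Proof.
have [dT _ dF _] := chart.
by rewrite /mobz mob_facet dT dF opprB addrC subrK expr1 polyCN mulN1r.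
Qed.

End FacetChart.

(** * The glued poset and its down-set shared with P *)

Section Glue.
Variables (K : realFieldType) (nP kP nQ kQ nR kR d : nat).
Variables (VP : 'I_kP -> 'rV[K]_nP) (VQ : 'I_kQ -> 'rV[K]_nQ)
          (VR : 'I_kR -> 'rV[K]_nR).
Variables (FP : {set 'I_kP}) (FQ : {set 'I_kQ}).
Variables (phiP : {set 'I_kR} -> {set 'I_kP}) (phiQ : {set 'I_kR} -> {set 'I_kQ}).
Hypothesis chartP : facet_chart d%:Z VR VP FP phiP.
Hypothesis chartQ : facet_chart d%:Z VR VQ FQ phiQ.

Notation A := (glA VP VQ VR FP FQ).
Notation le := (glle phiP phiQ).

Lemma glle_refl : {in A, reflexive le}.
Proof. by move=> [a|[b|[r|]]] _ //=; apply: subxx. Qed.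

Lemma glA_P (a : {set 'I_kP}) :
  (inl a \in A) = [&& a \in faceset VP, ~~ (a \subset FP) & a != setT].
Proof. by rewrite in_set. Qed.

Lemma glA_Q (b : {set 'I_kQ}) :
  (inr (inl b) \in A) = [&& b \in faceset VQ, ~~ (b \subset FQ) & b != setT].
Proof. by rewrite in_set. Qed.

Lemma glA_R (r : {set 'I_kR}) :
  (inr (inr (Some r)) \in A) = (r \in faceset VR) && (r != setT).
Proof. by rewrite in_set. Qed.

Lemma glA_top : inr (inr None) \in A.
Proof. by rewrite in_set. Qed.

(** The face [phiP r] lies inside [FP], and no element of the P-part does. *)
Lemma glle_PR (a : {set 'I_kP}) (r : {set 'I_kR}) :
  inl a \in A -> inr (inr (Some r)) \in A -> (a \subset phiP r) = false.
Proof.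
rewrite glA_P glA_R => /and3P[_ naF _] /andP[rR _]; apply: contraNF naF => ar.
exact: subset_trans ar (chart_sub chartP rR).
Qed.

Lemma glle_QR (b : {set 'I_kQ}) (r : {set 'I_kR}) :
  inr (inl b) \in A -> inr (inr (Some r)) \in A -> (b \subset phiQ r) = false.
Proof.
rewrite glA_Q glA_R => /and3P[_ nbF _] /andP[rR _]; apply: contraNF nbF => br.
exact: subset_trans br (chart_sub chartQ rR).
Qed.

Lemma glle_anti : {in A &, antisymmetric le}.
Proof.
move=> [a|[b|[r|]]] [a'|[b'|[r'|]]] xA yA //=; rewrite ?glle_PR ?glle_QR ?andbF //=;
  by move=> h; do ?congr inr; do ?congr inl; do ?congr Some; apply/eqP; rewrite eqEsubset.
Qed.

Lemma glle_trans : {in A & &, transitive le}.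
Proof.
move=> [a|[b|[r|]]] [a'|[b'|[r'|]]] [a''|[b''|[r''|]]] yA xA zA //=;
  rewrite ?glle_PR ?glle_QR ?andbF //=; try exact: subset_trans.
(* What remains are the chains from the R-part through the R-part into the P-part or the Q-part,
   where monotonicity of the chart is used. *)
all: rewrite !glA_R in yA xA; move: yA xA => /andP[rR _] /andP[r'R _].
  by rewrite -(chart_mono chartP r'R rR); apply: subset_trans.
by rewrite -(chart_mono chartQ r'R rR); apply: subset_trans.
Qed.

Lemma sum_glA (M : zmodType) (G : glT kP kQ kR -> M) :
  \sum_(x in A) G x
  = \sum_(a | [&& a \in faceset VP, ~~ (a \subset FP) & a != setT]) G (inl a)
    + \sum_(b | [&& b \in faceset VQ, ~~ (b \subset FQ) & b != setT]) G (inr (inl b))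
    + \sum_(r | (r \in faceset VR) && (r != setT)) G (inr (inr (Some r)))
    + G (inr (inr None)).
Proof.
rewrite !big_sumType /= -!addrA.
congr (_ + (_ + _)); try by apply: eq_bigl => x; rewrite in_set.
rewrite (bigD1 None) ?in_set //= addrC; congr (_ + _).
rewrite (reindex_omap Some id) => [|[r|] //]; last by rewrite andbF.
by apply: eq_bigl => r; rewrite in_set andbT eqxx andbT.
Qed.

(** The P-part together with the R-part. Through [glP] its elements stand for all faces of P except
    [FP] and [setT]. *)
Definition glP_dom : {set glT kP kQ kR} :=
  [set x in A | match x with inl _ | inr (inr (Some _)) => true | _ => false end].

(* [setT] is a junk value outside [glP_dom]. *)
Definition glP (x : glT kP kQ kR) : {set 'I_kP} :=
  match x with inl a => a | inr (inr (Some r)) => phiP r | _ => setT end.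

Lemma glP_domP (a : {set 'I_kP}) : (inl a \in glP_dom) = (inl a \in A).
Proof. by rewrite in_set andbT. Qed.

Lemma glP_domR (r : {set 'I_kR}) :
  (inr (inr (Some r)) \in glP_dom) = (inr (inr (Some r)) \in A).
Proof. by rewrite in_set andbT. Qed.

Lemma glP_dom_sub : glP_dom \subset A.
Proof. by apply/subsetP => x; rewrite in_set => /andP[]. Qed.

Lemma glP_dom_down : {in glP_dom & A, forall x y, le y x -> y \in glP_dom}.
Proof.
move=> x y; rewrite ![_ \in glP_dom]in_set => /andP[xA] + yA.
by case: x y xA yA => [a|[b|[r|]]] [a'|[b'|[r'|]]] //= xA yA; rewrite ?yA // glle_QR.
Qed.

Lemma glP_face : {in glP_dom, forall x, glP x \in faceset VP}.
Proof.
move=> [a|[b|[r|]]]; rewrite ?glP_domP ?glP_domR ?glA_P ?glA_R /=.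
- by case/andP.
- by rewrite in_set andbF.
- by case/andP => rR _; apply: chart_face chartP _ rR.
- by rewrite in_set andbF.
Qed.

Lemma glP_mono : {in glP_dom &, forall x y, fle (glP x) (glP y) = le x y}.
Proof.
move=> x y; rewrite ![_ \in glP_dom]in_set => /andP[+ +] /andP[+ +].
case: x y => [a|[b|[r|]]] [a'|[b'|[r'|]]] //.
by rewrite !glA_R => /andP[rR _] _ /andP[r'R _] _; apply: (chart_mono chartP).
Qed.

(** The faces missed by [glP] are [FP] and [setT], and nothing else contains [FP]; hence no missed
    face lies below an image. *)
Lemma glP_down : {in glP_dom & faceset VP, forall x y, fle y (glP x) ->
  exists2 y0, y0 \in glP_dom & glP y0 = y}.
Proof.
move=> x y xD yP yx; have [yF|nyF] := boolP (y \subset FP).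
  have [r rR ry] := chart_onto chartP yP yF; subst y.
  exists (inr (inr (Some r))) => //; rewrite glP_domR glA_R rR /=.
  (* With [r = setT] the face [y] is [FP]; every [x] above it falls outside [glP_dom]. *)
  apply: contraL xD => /eqP rT; subst r; move: yx; rewrite (chart_setT chartP) /fle.
  case: x => [a|[b|[r|]]] /=; rewrite ?glP_domP ?glP_domR ?glA_P ?glA_R; last first.
  - by rewrite in_set andbF.
  - rewrite -(chart_setT chartP) => FPr; apply/negP => /andP[rR' /negP[]].
    by rewrite eqEsubset subsetT -(chart_mono chartP) ?setT_face.
  - by rewrite in_set andbF.
  - move=> Fa; apply/negP => /and3P[aP naF /eqP[]].
    by apply: (facet_maximal chartP) => //; apply: contraNneq naF => ->.
exists (inl y) => //; rewrite glP_domP glA_P yP nyF /=.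
apply: contraL xD => /eqP yT; subst y; move: yx; rewrite /fle subTset.
case: x => [a|[b|[r|]]] /= => /eqP xT; rewrite ?glP_domP ?glP_domR ?glA_P ?glA_R.
- by rewrite xT eqxx !andbF.
- by rewrite in_set andbF.
- apply/negP => /andP[rR _]; move/negP: nyF; apply.
  by rewrite -xT (chart_sub chartP).
- by rewrite in_set andbF.
Qed.

Lemma glP_rank : {in glP_dom, forall x, affdim VP (glP x) = glrk d VP VQ VR x}.
Proof.
move=> x; rewrite [_ \in _]in_set => /andP[+ +]; case: x => [a|[b|[r|]]] //.
by rewrite glA_R => /andP[rR _] _; apply: (chart_rank chartP).
Qed.

Lemma mob_glP : {in glP_dom &, forall x y,
  mob A le x y = face_mob VP (glP x) (glP y)}.
Proof.
move=> x y xD yD; apply/esym.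
exact: (mob_embedding glle_refl glle_anti glle_trans (@fle_anti _ _) (@fle_trans _ _)
  glP_dom_sub glP_dom_down glP_face glP_mono glP_down).
Qed.

Lemma sum_mobz_glP : {in glP_dom, forall y,
  \sum_(x in A) mobz A le (glrk d VP VQ VR) x y
  = \sum_(a in faceset VP) face_mobz VP a (glP y)}.
Proof.
move=> y yD; apply/esym.
exact: (sum_mobz_embedding glle_refl glle_anti glle_trans (@fle_anti _ _) (@fle_trans _ _)
  glP_dom_sub glP_dom_down glP_face glP_mono glP_down (@fle_refl _ _) glP_rank).
Qed.


Lemma mob_glPP (a a' : {set 'I_kP}) : inl a \in A -> inl a' \in A ->
  mob A le (inl a) (inl a') = face_mob VP a a'.
Proof. by move=> aA a'A; rewrite mob_glP ?glP_domP. Qed.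

Lemma mob_glRP (r : {set 'I_kR}) (a : {set 'I_kP}) :
  inr (inr (Some r)) \in A -> inl a \in A ->
  mob A le (inr (inr (Some r))) (inl a) = face_mob VP (phiP r) a.
Proof. by move=> rA aA; rewrite mob_glP ?glP_domP ?glP_domR. Qed.

Lemma mob_glRR (r r' : {set 'I_kR}) :
  inr (inr (Some r)) \in A -> inr (inr (Some r')) \in A ->
  mob A le (inr (inr (Some r))) (inr (inr (Some r'))) = face_mob VR r r'.
Proof.
move=> rA r'A; rewrite mob_glP ?glP_domR //=; rewrite !glA_R in rA r'A.
by apply: (mob_chart chartP); [case/andP: rA | case/andP: r'A].
Qed.

Lemma sum_mobz_glA_P (a : {set 'I_kP}) : inl a \in A ->
  \sum_(x in A) mobz A le (glrk d VP VQ VR) x (inl a)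
  = \sum_(a' in faceset VP) face_mobz VP a' a.
Proof. by move=> aA; rewrite sum_mobz_glP ?glP_domP. Qed.

Lemma sum_mobz_glA_R (r : {set 'I_kR}) : inr (inr (Some r)) \in A ->
  \sum_(x in A) mobz A le (glrk d VP VQ VR) x (inr (inr (Some r)))
  = \sum_(s in faceset VR) face_mobz VR s r.
Proof.
move=> rA; rewrite sum_mobz_glP ?glP_domR //=.
by apply: (sum_mobz_chart chartP); move: rA; rewrite glA_R => /andP[].
Qed.

(* The sums of mu(r, .) over all of P and over all of R vanish, and the R-faces are
   exactly the faces of P below the facet FP. *)
Lemma sum_mob_glRP (r : {set 'I_kR}) : inr (inr (Some r)) \in A ->
  \sum_(a | [&& a \in faceset VP, ~~ (a \subset FP) & a != setT])
    mob A le (inr (inr (Some r))) (inl a) = - face_mob VP (phiP r) setT.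
Proof.
move=> rA; have := rA; rewrite glA_R => /andP[rR nrT].
have sP : \sum_(S in faceset VP) face_mob VP (phiP r) S = 0.
  rewrite (sum_mob_max (@fle_refl _ _) (@fle_anti _ _) (@fle_trans _ _) _ (setT_face VP)).
  - have nphirT : phiP r != setT.
      apply: contraNneq (facet_neqT chartP) => rT.
      by rewrite -subTset -rT (chart_sub chartP).
    by rewrite (negbTE nphirT).
  - exact: chart_face chartP _ rR.
  - by move=> S _; rewrite /fle subsetT.
have sR : \sum_(s in faceset VR) face_mob VP (phiP r) (phiP s) = 0.
  under eq_bigr => s sR do rewrite (mob_chart chartP) //.
  rewrite (sum_mob_max (@fle_refl _ _) (@fle_anti _ _) (@fle_trans _ _) rR (setT_face VR)).
  - by rewrite (negbTE nrT).
  - by move=> S _; rewrite /fle subsetT.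
move: sP; rewrite (sum_faces chartP) sR addr0 => /eqP; rewrite addr_eq0 => /eqP <-.
by apply: eq_bigr => a aA; rewrite mob_glRP // glA_P.
Qed.

(** The rows of [a] in the glued poset and in P both sum to 0 and agree on the P-part. Their other
    entries before the maximum vanish: [a] is below no face inside [FP] and no element of the Q-part
    or R-part. *)
Lemma mob_glP_top (a : {set 'I_kP}) : inl a \in A ->
  mob A le (inl a) (inr (inr None)) = face_mob VP a setT.
Proof.
move=> aA; have := aA; rewrite glA_P => /and3P[aP naF naT].
have : \sum_(x in A) mob A le (inl a) x = 0.
  rewrite (sum_mob_max glle_refl glle_anti glle_trans aA glA_top) //.
  by case=> [?|[?|[?|]]].
have : \sum_(S in faceset VP) face_mob VP a S = 0.
  rewrite (sum_mob_max (@fle_refl _ _) (@fle_anti _ _) (@fle_trans _ _) aP (setT_face VP)).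
  - by rewrite (negbTE naT).
  - by move=> S _; rewrite /fle subsetT.
rewrite sum_glA (sum_faces chartP).
rewrite [X in _ + _ + X]big1 => [|r rR]; last first.
  apply: mob_nle => //; apply: contra naF => ar.
  exact: subset_trans ar (chart_sub chartP rR).
rewrite addr0 => /eqP; rewrite addr_eq0 => /eqP sP.
rewrite [X in _ + X + _ + _]big1 => [|b bA]; last first.
  by apply: mob_nle => //; apply: glle_refl.
rewrite [X in _ + _ + X + _]big1 => [|r rA]; last first.
  by apply: (mob_nle glle_refl) => //=; rewrite glle_PR // glA_R.
rewrite !addr0; under eq_bigr => b bA do rewrite mob_glPP // ?glA_P //.
by rewrite sP addrC => /eqP; rewrite subr_eq0 => /eqP.
Qed.

End Glue.

(** * Exchange of P and Q, and the column of the top element *)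

Section GlueTop.
Variables (K : realFieldType) (nP kP nQ kQ nR kR d : nat).
Variables (VP : 'I_kP -> 'rV[K]_nP) (VQ : 'I_kQ -> 'rV[K]_nQ)
          (VR : 'I_kR -> 'rV[K]_nR).
Variables (FP : {set 'I_kP}) (FQ : {set 'I_kQ}).
Variables (phiP : {set 'I_kR} -> {set 'I_kP}) (phiQ : {set 'I_kR} -> {set 'I_kQ}).
Hypothesis chartP : facet_chart d%:Z VR VP FP phiP.
Hypothesis chartQ : facet_chart d%:Z VR VQ FQ phiQ.

Notation A := (glA VP VQ VR FP FQ).
Notation le := (glle phiP phiQ).
Notation A' := (glA VQ VP VR FQ FP).
Notation le' := (glle phiQ phiP).

(** This isomorphism between the two orders of gluing turns facts about the P-part into facts about
    the Q-part. *)
Definition glswap (x : glT kP kQ kR) : glT kQ kP kR :=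
  match x with
  | inl a => inr (inl a)
  | inr (inl b) => inl b
  | inr (inr o) => inr (inr o)
  end.

Lemma mem_glswap x : (glswap x \in A') = (x \in A).
Proof. by rewrite [LHS]in_set [RHS]in_set; case: x => [a|[b|[r|]]]. Qed.

Lemma glswap_in : {in A, forall x, glswap x \in A'}.
Proof. by move=> x; rewrite mem_glswap. Qed.

Lemma glswap_mono : {in A &, forall x y, le' (glswap x) (glswap y) = le x y}.
Proof. by move=> [a|[b|[r|]]] [a'|[b'|[r'|]]]. Qed.

Lemma glswap_down : {in A & A', forall x y, le' y (glswap x) ->
  exists2 y0, y0 \in A & glswap y0 = y}.
Proof.
move=> x [b|[a|o]] _ yA' _; [exists (inr (inl b)) | exists (inl a) | exists (inr (inr o))] => //;
  by rewrite -mem_glswap.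
Qed.

Lemma mob_glswap : {in A &, forall x y,
  mob A le x y = mob A' le' (glswap x) (glswap y)}.
Proof.
move=> x y xA yA; apply/esym.
apply: (mob_embedding (glle_refl phiP phiQ) (glle_anti chartP chartQ)
  (glle_trans chartP chartQ) (glle_anti chartQ chartP) (glle_trans chartQ chartP)
  (subxx A) _ glswap_in glswap_mono glswap_down) => //.
Qed.

Lemma sum_mobz_glswap : {in A, forall y,
  \sum_(x in A) mobz A le (glrk d VP VQ VR) x y
  = \sum_(x in A') mobz A' le' (glrk d VQ VP VR) x (glswap y)}.
Proof.
move=> y yA; apply/esym.
apply: (sum_mobz_embedding (glle_refl phiP phiQ) (glle_anti chartP chartQ)
  (glle_trans chartP chartQ) (glle_anti chartQ chartP) (glle_trans chartQ chartP)
  (subxx A) _ glswap_in glswap_mono glswap_down (glle_refl phiQ phiP)) => //.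
by case=> [a|[b|[r|]]].
Qed.

Lemma sum_mobz_glA_Q (b : {set 'I_kQ}) : inr (inl b) \in A ->
  \sum_(x in A) mobz A le (glrk d VP VQ VR) x (inr (inl b))
  = \sum_(b' in faceset VQ) face_mobz VQ b' b.
Proof.
move=> bA; rewrite sum_mobz_glswap // (sum_mobz_glA_P chartQ chartP) //.
by rewrite (mem_glswap (inr (inl b))).
Qed.

(** In the row of [r], which sums to 0, the P-part and the Q-part contribute minus the first two
    terms. The R-part contributes minus the third, being the row of [r] in R without its last
    entry. *)
Lemma mob_glR_top (r : {set 'I_kR}) : inr (inr (Some r)) \in A ->
  mob A le (inr (inr (Some r))) (inr (inr None))
  = face_mob VP (phiP r) setT + face_mob VQ (phiQ r) setT + face_mob VR r setT.
Proof.
move=> rA; have := rA; rewrite glA_R => /andP[rR nrT].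
have rA' : inr (inr (Some r)) \in A' by apply: (glswap_in rA).
have : \sum_(x in A) mob A le (inr (inr (Some r))) x = 0.
  rewrite (sum_mob_max (glle_refl phiP phiQ) (glle_anti chartP chartQ)
    (glle_trans chartP chartQ) rA (glA_top _ _ _ _ _)) //.
  by case=> [?|[?|[?|]]].
have : \sum_(s in faceset VR) face_mob VR r s = 0.
  rewrite (sum_mob_max (@fle_refl _ _) (@fle_anti _ _) (@fle_trans _ _) rR (setT_face VR)).
  - by rewrite (negbTE nrT).
  - by move=> S _; rewrite /fle subsetT.
rewrite sum_glA sum_chart_faces (sum_mob_glRP chartP chartQ rA).
have -> : \sum_(b | [&& b \in faceset VQ, ~~ (b \subset FQ) & b != setT])
    mob A le (inr (inr (Some r))) (inr (inl b)) = - face_mob VQ (phiQ r) setT.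
  rewrite -(sum_mob_glRP chartQ chartP rA'); apply: eq_bigr => b bA.
  by rewrite mob_glswap // in_set.
under [X in _ -> _ + X + _ = 0 -> _]eq_bigr => s sR do
  rewrite (mob_glRR chartP chartQ rA) ?glA_R //.
move/eqP; rewrite addr_eq0 => /eqP ->.
by move/eqP; rewrite addrC addr_eq0 => /eqP ->; rewrite !opprD !opprK.
Qed.

Lemma mobz_glR_top (r : {set 'I_kR}) : affdim VR setT = d%:Z - 1 ->
  r \in faceset VR -> r != setT ->
  mobz A le (glrk d VP VQ VR) (inr (inr (Some r))) (inr (inr None))
  = face_mobz VP (phiP r) setT + face_mobz VQ (phiQ r) setT + 'X * face_mobz VR r setT.
Proof.
move=> dR rR nrT; have [dP _ _ _] := chartP; have [dQ _ _ _] := chartQ.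
rewrite /mobz mob_glR_top ?glA_R ?rR //= dP dQ dR.
rewrite (chart_rank chartP) // (chart_rank chartQ) //.
have : affdim VR r <= d%:Z - 1 by rewrite -dR affdim_mono ?subsetT.
set k := affdim VR r => kd.
(* The new top has rank one more than the top of R, whence the factor ['X] on the R-term;
   [k <= d - 1] keeps the absolute value exact. *)
have -> : d%:Z - k = (absz (d%:Z - 1 - k)%R).+1%:Z.
  by rewrite intS gez0_abs ?subr_ge0 // addrA [1 + _]addrC subrK.
by rewrite /= exprS !polyCD !mulrDl [(face_mob VR _ _)%:P * _]mulrCA.
Qed.

(** The right-hand columns contain extra terms: 1 for the top and [- 'X] for the facet, in each of P
    and Q, and ['X] for the top of R. They total [2 - 'X], while the new top contributes 1; hence
    the correction [- 1 + 'X]. *)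
Lemma sum_mobz_gl_top : affdim VR setT = d%:Z - 1 ->
  \sum_(x in A) mobz A le (glrk d VP VQ VR) x (inr (inr None))
  = \sum_(a in faceset VP) face_mobz VP a setT
    + \sum_(b in faceset VQ) face_mobz VQ b setT
    + 'X * \sum_(r in faceset VR) face_mobz VR r setT - 1 + 'X.
Proof.
move=> dR; have [dP _ _ _] := chartP; have [dQ _ _ _] := chartQ.
have mobz_id (U : finType) (B : {set U}) (le0 : rel U) rk x : mobz B le0 rk x x = 1.
  by rewrite /mobz mob_id subrr mulr1.
rewrite sum_glA (sum_faces chartP) (sum_faces chartQ) !sum_chart_faces !mobz_id.
rewrite (chart_setT chartP) (chart_setT chartQ) (mobz_facet chartP) (mobz_facet chartQ).
under [X in _ + X + _ = _]eq_bigr => r /andP[rR nrT] do rewrite mobz_glR_top //.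
rewrite !big_split /= -mulr_sumr.
rewrite (eq_bigr (fun a => face_mobz VP a setT)); last first.
  by move=> a aA; rewrite /mobz (mob_glP_top chartP chartQ) ?glA_P //= dP.
rewrite [X in _ + X + _ + _ = _](eq_bigr (fun b => face_mobz VQ b setT)); last first.
  move=> b bA; rewrite /mobz mob_glswap ?glA_top ?glA_Q //=.
  by rewrite (mob_glP_top chartQ chartP) ?glA_P //= dQ.
ring.
Qed.

End GlueTop.

(** * The top polynomial and the final count by columns *)

Lemma gpoly_top (K : realFieldType) (n k : nat) (V : 'I_k -> 'rV[K]_n) :
  gpoly (faceset V) (@fle k) (affdim V) (affdim V setT)
  = \sum_(S in faceset V) face_mobz V S setT.
Proof.
apply: eq_bigr => S SV; rewrite (bigD1 setT) /=; last first.
  by rewrite setT_face /fle subsetT affdim_mono ?subsetT /=.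
(* A face other than [setT] has smaller dimension, so [setT] is the only upper end that
   contributes. *)
rewrite big1 ?addr0 // => S' /andP[/andP[S'V /andP[_ dS']] nS'T].
have := affdim_lt S'V (S' := setT).
by rewrite properEneq nS'T subsetT ltNge dS' => /(_ isT).
Qed.

Theorem mainTheorem11 (K : realFieldType) (d nP kP nQ kQ nR kR : nat)
  (VP : 'I_kP -> 'rV[K]_nP) (VQ : 'I_kQ -> 'rV[K]_nQ) (VR : 'I_kR -> 'rV[K]_nR)
  (FP : {set 'I_kP}) (FQ : {set 'I_kQ})
  (phiP : {set 'I_kR} -> {set 'I_kP}) (phiQ : {set 'I_kR} -> {set 'I_kQ}) :
  polytope_of_dim VP d%:Z ->
  polytope_of_dim VQ d%:Z ->
  polytope_of_dim VR (d%:Z - 1) ->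
  FP \in faceset VP -> affdim VP FP = d%:Z - 1 ->
  FQ \in faceset VQ -> affdim VQ FQ = d%:Z - 1 ->
  face_iso VR VP FP phiP ->
  face_iso VR VQ FQ phiQ ->
  Mpoly (glA VP VQ VR FP FQ) (glle phiP phiQ) (glrk d VP VQ VR)
  = Mpoly (faceset VP) (@fle kP) (affdim VP)
    + Mpoly (faceset VQ) (@fle kQ) (affdim VQ)
    - Mpoly (faceset VR) (@fle kR) (affdim VR)
    - 1 + 'X
    - (1 - 'X) * gpoly (faceset VR) (@fle kR) (affdim VR) (d%:Z - 1).
Proof.
move=> [_ dP] [_ dQ] [_ dR] FPP dFP FQQ dFQ isoP isoQ.
have chartP : facet_chart d VR VP FP phiP by [].
have chartQ : facet_chart d VR VQ FQ phiQ by [].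
rewrite -dR gpoly_top (MpolyE (glle_refl phiP phiQ)) !(MpolyE (@fle_refl _ _)).
rewrite sum_glA (sum_mobz_gl_top chartP chartQ) //.
(* Each column below the top is now replaced by the column of the corresponding face in P, Q or
   R. *)
rewrite (eq_bigr _ (fun a aA => sum_mobz_glA_P chartP chartQ (etrans (glA_P _ _ _ _ _ a) aA))).
rewrite (eq_bigr _ (fun b bA => sum_mobz_glA_Q chartP chartQ (etrans (glA_Q _ _ _ _ _ b) bA))).
rewrite (eq_bigr _ (fun r rA => sum_mobz_glA_R chartP chartQ (etrans (glA_R _ _ _ _ _ r) rA))).
rewrite (sum_faces chartP (fun S => \sum_(a in _) mobz _ _ _ a S)).
rewrite (sum_faces chartQ (fun S => \sum_(a in _) mobz _ _ _ a S)).
(* The columns of P and of Q at faces inside the glued facet are columns of R. *)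
rewrite (eq_bigr _ (fun r rR => sum_mobz_chart chartP rR)).
rewrite (eq_bigr _ (fun r rR => sum_mobz_chart chartQ rR)).
rewrite (sum_chart_faces VR (fun r => \sum_(s in _) mobz _ _ _ s r)).
(* The columns of P and Q at [setT] cancel. That of R is absent from the proper part and returns
   with factor ['X] from the top, giving [- (1 - 'X)]. *)
ring.
Qed.
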